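(* Let $(X,\mathcal{F})$ be a convexity space whose second Radon number $r_2$ is finite. Then for every integer $k\geq 2$, \[ r_k\leq c(r_2)\,k^2\log^2 k, \] where $c(r_2)$ is a constant depending only on $r_2$.
   Context: A convexity space on a ground set $X$ is a family $\mathcal{F}\subset 2^X$ (whose members are called convex sets) such that $\emptyset\in\mathcal{F}$, $X\in\mathcal{F}$, and the intersection of any collection of members of $\mathcal{F}$ belongs to $\mathcal{F}$. The convex hull $\operatorname{conv} P$ of $P\subset X$ is the intersection of all convex sets containing $P$. The $k$-th Radon number $r_k$ of $(X,\mathcal{F})$ is the minimum natural number, if it exists, such that every set $P\subset X$ with at least $r_k$ points admits a partition $P=P_1\cup\dots\cup P_k$ into $k$ parts with $\operatorname{conv}P_1\cap\dots\cap\operatorname{conv}P_k\neq\emptyset$. *)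

(* Defs.v *)
From mathcomp Require Import all_boot all_order all_algebra.
From mathcomp Require Import all_classical all_reals all_analysis.

Set Implicit Arguments.
Unset Strict Implicit.
Unset Printing Implicit Defensive.

Local Open Scope classical_set_scope.
Local Open Scope card_scope.

Record convexity_space (X : Type) (F : set (set X)) : Prop := ConvexitySpace {
  convex_set0 : F set0 ;
  convex_setT : F [set: X] ;
  convex_bigcap : forall G : set (set X), G `<=` F -> F (\bigcap_(A in G) A) }.

Definition conv (X : Type) (F : set (set X)) (P : set X) : set X :=
  smallest F P.

(* [partition] requires nonempty parts. In a convexity space this costs
   nothing: set0 is convex, so an empty part would make the common
   intersection of the hulls empty. *)
Definition radon_property (X : Type) (F : set (set X)) (k r : nat) : Prop :=
  forall P : set X, `I_r #<= P ->
    exists Q : 'I_k -> set X,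
      partition [set: 'I_k] Q P /\ \bigcap_i conv F (Q i) !=set0.

(* A relation rather than a function, since the k-th Radon number need not
   exist: [is_radon_number F k r] says that r_k exists and is equal to r. *)
Definition is_radon_number (X : Type) (F : set (set X)) (k r : nat) : Prop :=
  radon_property F k r /\
  forall m : nat, radon_property F k m -> (r <= m)%N.

(* Main.v *)
(* By Levi's theorem the Helly number is less than r_2, so it suffices to color
   the points with k colors in such a way that, for some constant h >= r_2, the
   hulls of any h color classes meet. Jamison's product argument gives a
   constant r_h. Arrange the points in blocks of r_h rows of k points, and color
   every row of a block by a random cyclic shift of the k colors. A given h-tuple
   of colors is realized inside a block, by a Tverberg partition of a transversal
   of the rows, with probability at least q = h^(-r_h). There are k^h tuples, so
   O(log(k) / q) blocks already suffice; h k / q blocks are used below, which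
   amounts to O(k^2) points and is enough because ln k >= ln 2. *)
Require Import Defs.
From mathcomp Require Import all_boot all_order all_algebra.
From mathcomp Require Import all_classical all_reals all_analysis.

From mathcomp Require Import zify.

Set Implicit Arguments.
Unset Strict Implicit.
Unset Printing Implicit Defensive.

Import Order.TTheory GRing.Theory Num.Theory.

Local Open Scope classical_set_scope.
Local Open Scope card_scope.

Local Notation conv := Defs.conv.

(** * Hulls, and sets of points versus families of points *)

Section Conv.
Context {X : Type} {F : set (set X)}.

Lemma conv_sub (A B : set X) : A `<=` B -> conv F A `<=` conv F B.
Proof. by move=> AB x Ax C [FC BC]; apply: Ax; split=> // y /AB /BC. Qed.

Lemma conv_sub_convex (A C : set X) : F C -> A `<=` C -> conv F A `<=` C.
Proof. by move=> FC AC; exact: smallest_sub. Qed.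

Lemma convex_conv (A : set X) : convexity_space F -> F (conv F A).
Proof. by move=> cF; apply: (convex_bigcap cF) => B []. Qed.

Lemma conv_conv_sub (A B : set X) : convexity_space F ->
  A `<=` conv F B -> conv F A `<=` conv F B.
Proof. by move=> cF; apply: conv_sub_convex; exact: convex_conv. Qed.

Lemma conv_nonempty (A : set X) : convexity_space F ->
  conv F A !=set0 -> A !=set0.
Proof.
move=> cF [x Ax]; apply/set0P/negP => /eqP A0.
by move: Ax; rewrite A0 => /(conv_sub_convex (convex_set0 cF) (@subset_refl _ _)).
Qed.

End Conv.

(* The points are a family, so they may coincide: the Tverberg points of several
   groups, or the witnesses in Helly's theorem, need not be distinct. *)
Definition tverberg_family {X : Type} (F : set (set X)) (I K : Type) : Prop :=
  forall p : I -> X, exists (f : I -> K) (x : X),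
    forall a, conv F (p @` [set i | f i = a]) x.

Section Points.
Context {X : Type}.

Lemma card_ge_ord (P : set X) (n : nat) : `I_n #<= P ->
  exists2 p : 'I_n -> X, injective p & forall i, P (p i).
Proof.
move=> /card_leP[g].
have In (i : 'I_n) : (i : nat) \in `I_n by rewrite inE /=.
exists (fun i => val (g (SigSub (In i)))).
  move=> i j /val_inj /(@inj _ _ _ g) /= gij.
  by apply: val_inj; have /(congr1 val) := gij (mem_set I) (mem_set I).
by move=> i; have := valP (g (SigSub (In i))); rewrite inE.
Qed.

Lemma card_ge_range (n : nat) (p : 'I_n -> X) : injective p ->
  `I_n #<= range p.
Proof.
case: n p => [|n] p pI; first by rewrite II0; exact: card_ge0.
have /card_eqPle[_ In] : (fun m => p (inord m)) @` `I_n.+1 #= `I_n.+1.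
  apply: inj_card_eq => i j /set_mem /= ni /set_mem /= nj /pI.
  by move=> /(congr1 (@nat_of_ord _)); rewrite !inordK.
by apply: card_le_trans In _; apply: subset_card_le => _ [m _ <-]; exists (inord m).
Qed.

End Points.

(** * Tverberg partitions with many parts *)

Section Radon.
Context {X : Type} {F : set (set X)}.
Hypothesis cF : convexity_space F.

Lemma radon_family (r : nat) : radon_property F 2 r ->
  tverberg_family F 'I_r bool.
Proof.
move=> rad p; have [pI|/existsNP[i /existsNP[j /not_implyP[pij ij]]]] := pselect (injective p).
  have [Q [[Qp Qt Q0] [x Qx]]] := rad _ (card_ge_range pI).
  exists (fun i => `[< Q ord0 (p i) >]), x => a.
  pose b : 'I_2 := if a then ord0 else ord_max.
  apply: (conv_sub _ (Qx b I)) => y Qby.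
  have [i _ piy] : range p y by rewrite -Qp; exists b.
  exists i => //=; rewrite /b -{y}piy in Qby *.
  case: {+}a @b Qby => /= Qy; first exact/asboolP.
  apply/asboolP => Q0y.
  by have /(congr1 val) := Qt _ _ I I (ex_intro _ (p i) (conj Q0y Qy)).
(* A repeated point lies in both classes once its two indices are separated. *)
exists (fun l => l == i), (p i) => -[]; apply: sub_gen_smallest.
  by exists i => //=; rewrite eqxx.
by exists j => //=; apply/negbTE/eqP => /esym.
Qed.

(* Jamison: a Tverberg partition of the Tverberg points of the groups. *)
Lemma tverberg_family_prod (I J K L : Type) :
  tverberg_family F I K -> tverberg_family F J L ->
  tverberg_family F (J * I) (L * K).
Proof.
move=> tI tJ p.
have /choice[f /choice[x fx]] j := tI (fun i => p (j, i)).
have [g [y gy]] := tJ x.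
exists (fun z => (g z.1, f z.1 z.2)), y => -[b a].
apply: conv_conv_sub (gy b) => // _ [j /= gj <-].
apply: conv_sub (fx j a) => _ [i /= fi <-].
by exists (j, i) => //=; rewrite gj fi.
Qed.

End Radon.

(** Each product with a Radon partition doubles the number of parts. [I] and [K] are chosen before
    [X] and [F], so that the final constant depends on [r] alone. *)
Lemma tverberg_family_large (r n : nat) : exists I K : finType, (n < #|K|)%N /\
  forall (X : Type) (F : set (set X)), convexity_space F ->
    radon_property F 2 r -> tverberg_family F I K.
Proof.
elim: n => [|n [I [K [nK tIK]]]].
  exists unit, unit; rewrite card_unit; split=> // X F cF rad p.
  exists id, (p tt) => -[]; apply: sub_gen_smallest.
  by exists tt.
exists ('I_r * I)%type, (bool * K)%type; split; last first.
  move=> X F cF rad; apply: tverberg_family_prod => //; first exact: tIK.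
  exact: radon_family.
by rewrite card_prod card_bool mul2n -addnn -addn1 leq_add// (leq_trans _ nK).
Qed.

(** * Levi's theorem: Radon implies Helly *)

Section Helly.
Context {X : Type} {F : set (set X)}.

(** Induction on the length: deleting each of the first [r] entries in turn leaves a shorter list
    with a common point, and a Radon point of these [r] points serves the whole list. Deletion is by
    position, so repeated entries are harmless. *)
Lemma helly_seq (r : nat) (J : eqType) (C : J -> set X) :
  radon_property F 2 r -> (forall c, F (C c)) ->
  (forall s : seq J, (size s <= r)%N -> exists x, forall c, c \in s -> C c x) ->
  forall s : seq J, exists x, forall c, c \in s -> C c x.
Proof.
move=> rad FC Cr s; have [n] := ubnP (size s).
elim: n s => // n IHn s sn; have [/Cr//|rs] := leqP (size s) r.
have /choice[p pC] (i : 'I_r) : exists x, forall c j, (j < size s)%N ->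
    j != i :> nat -> c = nth c s j -> C c x.
  have [|x xC] := IHn (take i s ++ drop i.+1 s).
    rewrite size_cat size_take size_drop.
    have := ltn_trans (ltn_ord i) rs => is_; rewrite is_.
    by move: sn is_; lia.
  exists x => c j js ji ->; apply: xC; rewrite mem_cat.
  have [ltji|] := ltnP j i.
    apply/orP; left; rewrite -(nth_take c ltji) mem_nth// size_take.
    by rewrite (ltn_trans (ltn_ord i) rs).
  rewrite leq_eqVlt eq_sym (negbTE ji) /= => ltij.
  apply/orP; right; rewrite -(subnKC ltij) -nth_drop mem_nth// size_drop.
  by rewrite ltn_sub2r// (leq_ltn_trans ltij).
have [f [x fx]] := radon_family rad p.
exists x => c cs; have jsize : (index c s < size s)%N by rewrite index_mem.
(* The color class avoiding the index of [c] has its hull inside [C c]. *)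
have [b bP] : exists b, forall i : 'I_r, f i = b -> index c s != i.
  have [jr|rj] := ltnP (index c s) r.
    exists (~~ f (Ordinal jr)) => i fi; apply/eqP => ij.
    have ei : i = Ordinal jr by exact: val_inj.
    by move: fi; rewrite ei; case: (f _).
  by exists true => i _; rewrite neq_ltn (leq_trans (ltn_ord i) rj) orbT.
apply: (conv_sub_convex (FC c) _ (fx b)) => _ [i fi <-].
by apply: pC jsize _ _; [exact: bP|rewrite nth_index].
Qed.

(** A short list is padded with [c0] to a tuple indexed by [K], the form in which blocks realize
    colors. *)
Lemma helly (r : nat) (K J : finType) (C : J -> set X) :
  radon_property F 2 r -> (forall c, F (C c)) -> (r <= #|K|)%N ->
  (forall T : {ffun K -> J}, exists x, forall a, C (T a) x) ->
  (0 < #|J|)%N -> exists x, forall c, C c x.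
Proof.
move=> rad FC rK CT /card_gt0P[c0 _].
have [|x xC] := @helly_seq r J C rad FC _ (enum J); last first.
  by exists x => c; apply: xC; rewrite mem_enum.
move=> s sr; have [x xC] := CT [ffun a => nth c0 s (enum_rank a)].
exists x => c cs.
have iK : (index c s < #|K|)%N by rewrite (leq_trans _ rK)// (leq_trans _ sr)// index_mem.
have := xC (enum_val (Ordinal iK)).
by rewrite ffunE enum_valK /= nth_index.
Qed.

End Helly.

(** * Derandomized choice of the shifts, by counting *)

Section Greedy.
Context (S T : finType) (good : nat -> S -> T -> bool) (Q : nat).
Hypothesis goodQ : forall m t, (#|S| <= Q * #|[set s | good m s t]%SET|)%N.
Hypothesis S0 : (0 < #|S|)%N.

(** Averaging: count the good pairs in [S] times [U] in two ways. *)
Lemma greedy_step (m : nat) (U : {set T}) :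
  exists s, (#|U| <= Q * #|[set t in U | good m s t]%SET|)%N.
Proof.
apply/existsP; apply: contraT; rewrite negb_exists => /forallP lt.
have : (\sum_(s : S) Q * #|[set t in U | good m s t]%SET| < \sum_(s : S) #|U|)%N.
  have /card_gt0P[s0 _] := S0.
  rewrite (bigD1 s0)//= [ltnRHS](bigD1 s0)//= -addSn leq_add//.
    by rewrite ltnNge lt.
  by apply: leq_sum => s _; rewrite ltnW// ltnNge lt.
rewrite sum_nat_const -big_distrr/= ltnNge => /negP; case.
have -> : \sum_(s : S) #|[set t in U | good m s t]%SET|
        = \sum_(t in U) #|[set s | good m s t]%SET|.
  under eq_bigr => s _ do rewrite cardsE -sum1_card.
  under [RHS]eq_bigr => t _ do rewrite cardsE -sum1_card.
  rewrite (exchange_big_dep (mem U))/=; last by move=> s t _ /andP[].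
  by apply: eq_bigr => t tU; apply: eq_bigl => s; rewrite [LHS]unfold_in tU.
rewrite mulnC -sum_nat_const big_distrr/=.
exact: leq_sum.
Qed.

(** Each greedy choice keeps at most a fraction 1 - 1/Q of the tuples missed so far; powers of [Q]
    clear the denominators. *)
Lemma greedy (M : nat) : (0 < Q)%N -> exists s : nat -> S,
  (#|[set t | [forall m : 'I_M, ~~ good m (s m) t]]%SET| * Q ^ M
     <= #|T| * Q.-1 ^ M)%N.
Proof.
move=> Q0; elim: M => [|M [s IH]].
  have /card_gt0P[s0 _] := S0.
  by exists (fun=> s0); rewrite !muln1 max_card.
set U := [set t | _]%SET in IH.
have [s1 s1U] := greedy_step M U.
exists (fun m => if m == M then s1 else s m).
set V := [set t | _]%SET; set W := [set t in U | _]%SET in s1U.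
have VUW : (#|V| + #|W| <= #|U|)%N.
  rewrite -(cardsID W U) addnC leq_add//.
    by rewrite subset_leq_card//; apply/fintype.subsetP => t; rewrite !inE => /andP[-> ->].
  rewrite subset_leq_card//; apply/fintype.subsetP => t; rewrite !inE => /forallP Vt.
  have := Vt ord_max; rewrite eqxx => /negbTE ->; rewrite andbF /=.
  apply/forallP => m; have := Vt (widen_ord (leqnSn M) m).
  by rewrite /= ltn_eqF.
have VU : (#|V| * Q <= #|U| * Q.-1)%N.
  rewrite -subn1 mulnBr muln1 leq_subRL.
    by rewrite addnC; nia.
  by rewrite leq_pmulr.
rewrite !expnS mulnA (leq_trans (leq_mul VU (leqnn _)))//.
by rewrite mulnAC [leqRHS]mulnCA mulnC leq_mul2l IH orbT.
Qed.

End Greedy.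

(** Bernoulli's inequality gives (1 + 1/p)^p >= 2 for p = Q - 1 > 0. *)
Lemma double_exp_pred_le (Q : nat) : (0 < Q)%N -> (2 * Q.-1 ^ Q <= Q ^ Q)%N.
Proof.
case: Q => // -[//|q] _ /=; set p := q.+1.
have bern m : (p ^ m * (p + m) <= p.+1 ^ m * p)%N.
  elim: m => [|m IH]; first by rewrite addn0.
  rewrite !expnS -!mulnA; apply: leq_trans (leq_mul (leqnn p.+1) IH).
  by rewrite mulnCA [leqRHS]mulnCA leq_mul2l; apply/orP; right; lia.
have := bern p; rewrite addnn -mul2n mulnA leq_pmul2r// => pp.
rewrite (expnS p p) (expnS p.+1 p) mulnCA leq_mul//.
by rewrite mulnC.
Qed.

(** Every [Q] blocks halve the missed tuples, and k < 2^k, so [n * k] halvings leave fewer than one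
    of the k^n tuples. *)
Lemma exp_pred_mul_lt (Q k n : nat) : (0 < Q)%N -> (0 < n)%N -> (0 < k)%N ->
  (k ^ n * Q.-1 ^ (Q * (n * k)) < Q ^ (Q * (n * k)))%N.
Proof.
move=> Q0 n0 k0; have [->|q0] := posnP (Q.-1 ^ (Q * (n * k))).
  by rewrite muln0 expn_gt0 Q0.
apply: (@leq_trans (2 ^ (n * k) * Q.-1 ^ (Q * (n * k)))).
  by rewrite ltn_pmul2r// mulnC expnM ltn_exp2r// ltn_expl.
by rewrite !(expnM _ Q) -expnMn leq_exp2r ?muln_gt0 ?n0// double_exp_pred_le.
Qed.

(** * Coloring the blocks *)

Section Blocks.
Context {X : Type} {F : set (set X)}.
Hypothesis cF : convexity_space F.

(* For fixed [f : I -> K], the transversal [x] whose points [(i, x i)] receive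
   the colors [T (f i)] is uniformly distributed when the shift [s] is, and [s]
   is good as soon as [f] is a Tverberg partition of [x]. Each transversal has
   such an [f], so a proportion at least #|K|^-#|I| of the shifts is good. *)
Lemma good_shift_card (I K : finType) (k : nat) (p : I * 'I_k.+1 -> X)
    (T : {ffun K -> 'I_k.+1}) : tverberg_family F I K ->
  (#|{ffun I -> 'I_k.+1}| <= #|K| ^ #|I| *
    #|[set s : {ffun I -> 'I_k.+1} | `[< exists x, forall a,
        conv F (p @` [set z | (z.2 + s z.1)%R = T a]) x >]]%SET|)%N.
Proof.
move=> tIK; have /choice[f fP] (x : {ffun I -> 'I_k.+1}) :
    exists (f : {ffun I -> K}) y, forall a,
      conv F ((fun i => p (i, x i)) @` [set i | f i = a]) y.
  have [f [y fy]] := tIK (fun i => p (i, x i)).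
  exists (finfun f), y => a; apply: conv_sub (fy a) => _ [i fi <-].
  by exists i => //=; rewrite ffunE.
pose g x := (f x, [ffun i => (T (f x i) - x i)%R]).
have gI : injective g.
  move=> x y [fxy /ffunP xy]; apply/ffunP => i; have := xy i.
  by rewrite !ffunE fxy => /addrI /oppr_inj.
rewrite -card_ffun -[X in (_ <= X * _)%N]cardsT -cardsX -[leqLHS]cardsT -(card_imset _ gI).
apply/subset_leq_card/fintype.subsetP => _ /imsetP[x _ ->].
rewrite !inE /=; have [y fy] := fP x.
exists y => a; apply: conv_sub (fy a) => _ [i fi <-].
by exists (i, x i) => //=; rewrite ffunE fi addrC subrK.
Qed.

Lemma tverberg_family_blocks (r k : nat) (I K : finType) :
  radon_property F 2 r -> (r <= #|K|)%N -> (0 < #|K|)%N ->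
  tverberg_family F I K ->
  tverberg_family F
    ('I_(#|K| ^ #|I| * (#|K| * k.+1)) * (I * 'I_k.+1)) 'I_k.+1.
Proof.
set Q := (#|K| ^ #|I|)%N; set M := (Q * _)%N => rad rK K0 tIK p.
have Q0 : (0 < Q)%N by rewrite expn_gt0 K0.
have M0 : (0 < M)%N by rewrite !muln_gt0 Q0 K0.
(* [greedy] numbers its rounds by all naturals; the default block is used only beyond [M]. *)
pose q (m : nat) z := p (insubd (Ordinal M0) m, z).
pose good m (s : {ffun I -> 'I_k.+1}) (T : {ffun K -> 'I_k.+1}) :=
  `[< exists x, forall a, conv F (q m @` [set z | (z.2 + s z.1)%R = T a]) x >].
have S0 : (0 < #|{ffun I -> 'I_k.+1}|)%N by apply/card_gt0P; exists [ffun=> ord0].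
have [s] := @greedy _ _ good Q (fun m T => good_shift_card (q m) T tIK) S0 M Q0.
rewrite card_ffun card_ord => /leq_ltn_trans/(_ (exp_pred_mul_lt Q0 K0 (ltn0Sn k))).
rewrite -[ltnRHS]mul1n ltn_pmul2r; last by rewrite (expn_gt0 Q) Q0.
rewrite ltnS leqn0 => /eqP/cards0_eq Us.
exists (fun z : 'I_M * (I * 'I_k.+1) => (z.2.2 + s z.1 z.2.1)%R).
apply: (helly rad _ rK) => [c||]; first exact: convex_conv.
  move=> T; have /existsP[m] : [exists m : 'I_M, good m (s m) T].
    apply: contraT; rewrite negb_exists => UT.
    by have /setP/(_ T) := Us; rewrite !inE UT.
  move=> /asboolP[x xT]; exists x => a; apply: conv_sub (xT a) => _ [z zT <-].
  by exists (m, z) => //; rewrite /q valKd.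
by rewrite card_ord.
Qed.

Lemma radon_property_of_family (k : nat) (J : finType) :
  tverberg_family F J 'I_k.+1 -> radon_property F k.+1 #|J|.
Proof.
move=> tJ P /card_ge_ord[p pI pP].
have [f [x fx]] := tJ (p \o enum_rank).
(* Points of [P] outside the family get color [ord0]; this only enlarges a hull. *)
pose col y := if pselect (exists j, p (enum_rank j) = y) is left e
  then f (projT1 (cid e)) else ord0.
have colE j : col (p (enum_rank j)) = f j.
  rewrite /col; case: pselect => [e|[]]; last by exists j.
  by case: (cid e) => /= j' /pI /enum_rank_inj ->.
have sub a : (p \o enum_rank) @` [set j | f j = a] `<=` [set y | P y /\ col y = a].
  by move=> _ [j /= fj <-]; rewrite colE.
exists (fun a => [set y | P y /\ col y = a]); split; last first.
  by exists x => a _; apply: conv_sub (fx a); exact: sub.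
split.
- by apply/seteqP; split=> [y [a _ []]//|y Py]; exists (col y).
- by move=> a b _ _ [y [[_ <-] [_ <-]]].
- move=> a _; have [|y /sub] := @conv_nonempty _ _ ((p \o enum_rank) @` [set j | f j = a]) cF; first by exists x.
  by exists y.
Qed.

End Blocks.

(** * The bound on the Radon numbers *)

Lemma radon_number_exists (X : Type) (F : set (set X)) (k n : nat) :
  radon_property F k n -> exists2 m, is_radon_number F k m & (m <= n)%N.
Proof.
move=> /asboolP Fn.
have ex : exists m, `[< radon_property F k m >] by exists n.
have [m /asboolP Fm mP] := ex_minnP ex.
exists m; last exact: mP.
by split=> // l /asboolP; exact: mP.
Qed.

Local Open Scope ring_scope.

Theorem theorem1 (R : realType) :
  exists c : nat -> R,
    forall (X : Type) (F : set (set X)) (r2 : nat),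
      convexity_space F -> is_radon_number F 2 r2 ->
      forall k : nat, (2 <= k)%N ->
        exists rk : nat, is_radon_number F k rk /\
          rk%:R <= c r2 * k%:R ^+ 2 * ln (k%:R : R) ^+ 2.
Proof.
suff /choice[c cP] : forall r2 : nat, exists c : R,
    forall (X : Type) (F : set (set X)),
      convexity_space F -> is_radon_number F 2 r2 ->
      forall k : nat, (2 <= k)%N ->
        exists rk : nat, is_radon_number F k rk /\
          rk%:R <= c * k%:R ^+ 2 * ln (k%:R : R) ^+ 2.
  by exists c => X F r2; exact: cP.
move=> r; have [I [K [rK tIK]]] := tverberg_family_large r r.
(* For k colors, all blocks together hold N k^2 points. *)
pose N := (#|K| ^ #|I| * #|K| * #|I|)%N.
exists (N%:R / ln 2 ^+ 2) => X F cF [rad _] [//|k] k2.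
have := @tverberg_family_blocks _ _ cF _ k _ _ rad (ltnW rK) (leq_ltn_trans (leq0n r) rK) (tIK _ _ cF rad).
move=> /(radon_property_of_family cF)/radon_number_exists[rk rkP rkN].
exists rk; split=> //.
have ln2 : 0 < ln 2 :> R by rewrite ln_gt0// ltr1n.
have lnk : ln 2 <= ln k.+1%:R :> R by rewrite ler_ln ?posrE ?ltr0n// ler_nat.
have {}rkN : rk%:R <= N%:R * k.+1%:R ^+ 2 :> R.
  rewrite -natrX -natrM ler_nat (leq_trans rkN)// !card_prod !card_ord.
  by rewrite /N; lia.
apply: (le_trans rkN).
rewrite (mulrAC N%:R) -[leRHS]mulrA [X in _ <= _ * X]mulrC ler_peMr ?mulr_ge0//.
rewrite ler_pdivlMr ?exprn_gt0// mul1r ler_pXn2r// nnegrE ltW//.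
exact: lt_le_trans lnk.
Qed.
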